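(* Let $\Psi$ be any set of $\mathcal{L}_\bullet$-sequents. If for every sequent $\chi\vdash\delta\in\Psi$ each propositional variable in $\chi$ occurs only once in $\chi$, then the rule $$\frac{\Delta\vdash\phi\qquad \Gamma[\phi]\cdots[\phi]\vdash\psi}{\Gamma[\Delta]\cdots[\Delta]\vdash\psi}\ (\mathrm{mix})$$ is admissible in $\mathsf{G_{BDFNL}}(\odot\Psi)$, where $\Gamma[-]\cdots[-]$ is a context with one or more holes.
   Context: $\mathcal{L}_{\mathrm{LC}}$-formulas are built from propositional variables and $\top,\bot$ using $\wedge,\vee,\to,\bullet,\leftarrow$; $\mathcal{L}_\bullet$-formulas are built from propositional variables and $\top,\bot$ using only $\bullet$; an $\mathcal{L}_\bullet$-sequent is $\chi\vdash\delta$ with $\chi,\delta$ $\mathcal{L}_\bullet$-formulas. Structures: $\Gamma::=\phi\mid(\Gamma\odot\Gamma)\mid(\Gamma\barwedge\Gamma)$ with $\phi$ an $\mathcal{L}_{\mathrm{LC}}$-formula. A consecution is $\Gamma\vdash\phi$ with $\Gamma$ a structure and $\phi$ an $\mathcal{L}_{\mathrm{LC}}$-formula. A context $\Gamma[-]$ is a structure with a hole, and $\Gamma[\Delta]$ is the result of filling the hole with the structure $\Delta$ (similarly for several holes). A rule is admissible in a calculus if its conclusion is derivable whenever its premisses are. $\mathsf{G_{BDFNL}}$ has: Axioms: $\phi\vdash\phi$; $\Gamma\vdash\top$; $\Gamma[\bot]\vdash\phi$. Logical rules: from $\Delta\vdash\phi$ and $\Gamma[\psi]\vdash\gamma$ infer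 $\Gamma[\Delta\odot(\phi\to\psi)]\vdash\gamma$; from $\phi\odot\Gamma\vdash\psi$ infer $\Gamma\vdash\phi\to\psi$; from $\Gamma[\phi]\vdash\gamma$ and $\Delta\vdash\psi$ infer $\Gamma[(\phi\leftarrow\psi)\odot\Delta]\vdash\gamma$; from $\Gamma\odot\psi\vdash\phi$ infer $\Gamma\vdash\phi\leftarrow\psi$; from $\Gamma[\phi\odot\psi]\vdash\gamma$ infer $\Gamma[\phi\bullet\psi]\vdash\gamma$; from $\Gamma\vdash\phi$ and $\Delta\vdash\psi$ infer $\Gamma\odot\Delta\vdash\phi\bullet\psi$; from $\Gamma[\phi\barwedge\psi]\vdash\gamma$ infer $\Gamma[\phi\wedge\psi]\vdash\gamma$; from $\Gamma\vdash\phi$ and $\Delta\vdash\psi$ infer $\Gamma\barwedge\Delta\vdash\phi\wedge\psi$; from $\Gamma[\phi]\vdash\gamma$ and $\Gamma[\psi]\vdash\gamma$ infer $\Gamma[\phi\vee\psi]\vdash\gamma$; from $\Gamma\vdash\phi_i$ infer $\Gamma\vdash\phi_1\vee\phi_2$ ($i=1,2$). Structural rules: from $\Gamma[\Delta\barwedge\Delta]\vdash\phi$ infer $\Gamma[\Delta]\vdash\phi$; from $\Gamma[\Delta]\vdash\phi$ infer $\Gamma[\Sigma\barwedge\Delta]\vdash\phi$; from $\Gamma[\Delta\barwedge\Lambda]\vdash\phi$ infer $\Gamma[\Lambda\barwedge\Delta]\vdash\phi$; from $\Gamma[(\Delta_1\barwedge\Delta_2)\barwedge\Delta_3]\vdash\phi$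 infer $\Gamma[\Delta_1\barwedge(\Delta_2\barwedge\Delta_3)]\vdash\phi$. For an $\mathcal{L}_\bullet$-sequent $(\sigma)\ \chi\vdash\delta$ with propositional variables among $p_1,\dots,p_n$, the structural rule $(\odot\sigma)$ is: from $\Gamma[\delta[\Delta_1/p_1,\dots,\Delta_n/p_n]]\vdash\phi$ infer $\Gamma[\chi[\Delta_1/p_1,\dots,\Delta_n/p_n]]\vdash\phi$, where $\Delta_1,\dots,\Delta_n$ are arbitrary structures and $\delta[\Delta_1/p_1,\dots]$, $\chi[\Delta_1/p_1,\dots]$ are the structures obtained by uniformly substituting $\Delta_i$ for $p_i$ and $\odot$ for $\bullet$. $\mathsf{G_{BDFNL}}(\odot\Psi)$ is $\mathsf{G_{BDFNL}}$ extended with the rules $(\odot\sigma)$ for all $\sigma\in\Psi$.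
   Formalization: The formal theorem additionally assumes that ⊤ does not occur in χ for any χ ⊢ δ in Ψ; without this the claim is false: for Ψ = {⊤ ⊢ p}, q ⊢ ⊤ and ⊤ ⊢ r are derivable but q ⊢ r is not. *)

(* Defs.v *)
From Stdlib Require Import List Lia.
Import ListNotations.

Set Implicit Arguments.
Unset Strict Implicit.

Definition pvar := nat.

Inductive formula : Type :=
| Var (p : pvar)
| Top
| Bot
| And (a b : formula)
| Or (a b : formula)
| Imp (a b : formula)    (* a -> b *)
| Fus (a b : formula)    (* a bullet b *)
| Coimp (a b : formula). (* a <- b *)

Inductive bformula : Type :=
| BVar (p : pvar)
| BTop
| BBot
| BFus (a b : bformula).

Record bsequent : Type := BSequent { ante : bformula; succ : bformula }.

Fixpoint occ (p : pvar) (a : bformula) : nat :=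
  match a with
  | BVar q => if PeanoNat.Nat.eqb p q then 1 else 0
  | BTop | BBot => 0
  | BFus a b => occ p a + occ p b
  end.

Definition linear (a : bformula) : Prop :=
  forall p, 1 <= occ p a -> occ p a = 1.

Fixpoint top_free (a : bformula) : Prop :=
  match a with
  | BVar _ | BBot => True
  | BTop => False
  | BFus a b => top_free a /\ top_free b
  end.

Inductive structure : Type :=
| Leaf (a : formula)
| ODot (G H : structure)
| OMeet (G H : structure). (* the barred wedge *)

Definition consecution : Type := (structure * formula)%type.

Inductive ctx : Type :=
| Hole
| ODotL (C : ctx) (G : structure)
| ODotR (G : structure) (C : ctx)
| OMeetL (C : ctx) (G : structure)
| OMeetR (G : structure) (C : ctx).

Fixpoint fill (C : ctx) (D : structure) : structure :=
  match C with
  | Hole => D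
  | ODotL C G => ODot (fill C D) G
  | ODotR G C => ODot G (fill C D)
  | OMeetL C G => OMeet (fill C D) G
  | OMeetR G C => OMeet G (fill C D)
  end.

(* Contexts with any number of holes; [mfill] puts the same structure into
   every hole, and a leaf is never a hole, whatever its formula. *)
Inductive mctx : Type :=
| MHole
| MLeaf (a : formula)
| MODot (C D : mctx)
| MOMeet (C D : mctx).

Fixpoint holes (C : mctx) : nat :=
  match C with
  | MHole => 1
  | MLeaf _ => 0
  | MODot C D | MOMeet C D => holes C + holes D
  end.

Fixpoint mfill (C : mctx) (S : structure) : structure :=
  match C with
  | MHole => S
  | MLeaf a => Leaf a
  | MODot C D => ODot (mfill C S) (mfill D S)
  | MOMeet C D => OMeet (mfill C S) (mfill D S)
  end.

(* The constants are kept as the formulas Top and Bot.  The substitution [s] is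
   total, but only its values on the variables of [a] matter. *)
Fixpoint ssubst (s : pvar -> structure) (a : bformula) : structure :=
  match a with
  | BVar p => s p
  | BTop => Leaf Top
  | BBot => Leaf Bot
  | BFus a b => ODot (ssubst s a) (ssubst s b)
  end.

Inductive derivable (Psi : bsequent -> Prop) : structure -> formula -> Prop :=
| ax_id a :
    derivable Psi (Leaf a) a
| ax_top G :
    derivable Psi G Top
| ax_bot C a :
    derivable Psi (fill C (Leaf Bot)) a
| imp_l C D a b c :
    derivable Psi D a ->
    derivable Psi (fill C (Leaf b)) c ->
    derivable Psi (fill C (ODot D (Leaf (Imp a b)))) c
| imp_r G a b :
    derivable Psi (ODot (Leaf a) G) b ->
    derivable Psi G (Imp a b)
| coimp_l C D a b c :
    derivable Psi (fill C (Leaf a)) c ->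
    derivable Psi D b ->
    derivable Psi (fill C (ODot (Leaf (Coimp a b)) D)) c
| coimp_r G a b :
    derivable Psi (ODot G (Leaf b)) a ->
    derivable Psi G (Coimp a b)
| fus_l C a b c :
    derivable Psi (fill C (ODot (Leaf a) (Leaf b))) c ->
    derivable Psi (fill C (Leaf (Fus a b))) c
| fus_r G D a b :
    derivable Psi G a ->
    derivable Psi D b ->
    derivable Psi (ODot G D) (Fus a b)
| and_l C a b c :
    derivable Psi (fill C (OMeet (Leaf a) (Leaf b))) c ->
    derivable Psi (fill C (Leaf (And a b))) c
| and_r G D a b :
    derivable Psi G a ->
    derivable Psi D b ->
    derivable Psi (OMeet G D) (And a b)
| or_l C a b c :
    derivable Psi (fill C (Leaf a)) c ->
    derivable Psi (fill C (Leaf b)) c ->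
    derivable Psi (fill C (Leaf (Or a b))) c
| or_r1 G a b :
    derivable Psi G a ->
    derivable Psi G (Or a b)
| or_r2 G a b :
    derivable Psi G b ->
    derivable Psi G (Or a b)
| contraction C D a :
    derivable Psi (fill C (OMeet D D)) a ->
    derivable Psi (fill C D) a
| weakening C S D a :
    derivable Psi (fill C D) a ->
    derivable Psi (fill C (OMeet S D)) a
| exchange C D L a :
    derivable Psi (fill C (OMeet D L)) a ->
    derivable Psi (fill C (OMeet L D)) a
| associativity C D1 D2 D3 a :
    derivable Psi (fill C (OMeet (OMeet D1 D2) D3)) a ->
    derivable Psi (fill C (OMeet D1 (OMeet D2 D3))) a
| odot_rule sigma C s a :
    Psi sigma ->
    derivable Psi (fill C (ssubst s (succ sigma))) a ->
    derivable Psi (fill C (ssubst s (ante sigma))) a.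

Definition rule : Type := list consecution -> consecution -> Prop.

Definition admissible (Psi : bsequent -> Prop) (R : rule) : Prop :=
  forall prems concl, R prems concl ->
    Forall (fun c => derivable Psi (fst c) (snd c)) prems ->
    derivable Psi (fst concl) (snd concl).

Inductive mix : rule :=
| Mix (C : mctx) (D : structure) (a b : formula) :
    1 <= holes C ->
    mix [(D, a); (mfill C (Leaf a), b)] (mfill C D, b).

(* Linearity of the antecedents alone does not make [mix] admissible: nothing
   can replace an occurrence of Top that the rule of a sequent puts into its
   conclusion.  With the rule of the sequent Top |- 0, the consecutions
   1 |- Top and Top |- 2 are derivable, but 1 |- 2 is not. *)
Section MixNeedsTopFree.

Let top_var (sigma : bsequent) : Prop := sigma = BSequent BTop (BVar 0).

Fixpoint only_var (p : pvar) (G : structure) : Prop :=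
  match G with
  | Leaf a => a = Var p
  | ODot G H | OMeet G H => only_var p G /\ only_var p H
  end.

Lemma only_var_fill p C D :
  only_var p (fill C D) <-> only_var p (fill C (Leaf (Var p))) /\ only_var p D.
Proof. induction C; simpl; tauto. Qed.

Lemma top_var_underivable G c :
  derivable top_var G c -> only_var 1 G -> c <> Var 2.
Proof.
  induction 1; intros HG Hc;
    try (apply only_var_fill in HG; destruct HG as [HC HG]); simpl in *;
    try discriminate; try (intuition discriminate).
  - congruence.
  - apply IHderivable; auto. apply only_var_fill; simpl; tauto.
  - apply IHderivable; auto. apply only_var_fill; simpl; tauto.
  - apply IHderivable; auto. apply only_var_fill; simpl; tauto.
  - apply IHderivable; auto. apply only_var_fill; simpl; tauto.
  - unfold top_var in *; subst sigma. discriminate.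
Qed.

(* Hence [top_free] cannot be dropped as a hypothesis on the antecedents. *)
Lemma mix_not_admissible_of_linear :
  ~ (forall Psi : bsequent -> Prop,
       (forall sigma, Psi sigma -> linear (ante sigma)) ->
       admissible Psi mix).
Proof.
  intro H.
  assert (Hlin : forall sigma, top_var sigma -> linear (ante sigma)).
  { intros sigma -> p; simpl; lia. }
  apply (@top_var_underivable (Leaf (Var 1)) (Var 2)); [|reflexivity..].
  refine (H _ Hlin _ _ (@Mix MHole (Leaf (Var 1)) Top (Var 2) (le_n 1)) _).
  repeat constructor; simpl.
  exact (@odot_rule top_var (BSequent BTop (BVar 0)) Hole
           (fun _ => Leaf (Var 2)) (Var 2) eq_refl (ax_id _ _)).
Qed.

End MixNeedsTopFree.

(* Main.v *)
From Stdlib Require Import Lia PeanoNat.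
Require Import Defs.

(** Mix elimination, by structural induction on the mix formula [a].

    For a fixed derivation of [D |- a], the mix is pushed upwards through the
    derivation of the other premiss ([mix_step]).  Replacing several occurrences
    of [a] at once makes contraction, and the repetition of a variable in the
    succedent of a sequent of [Psi], harmless.  An [odot_rule] commutes with the
    replacement because the variables of its antecedent [chi] occur there only
    once: a replacement inside [chi] under [s] is then again an instance of [chi],
    under a substitution obtained from [s] by replacement ([repl_ssubst_inv]).  The
    occurrences that come from the constants of [chi] are not of this form: [Top]
    is excluded by [top_free], and if an occurrence of [Bot] is replaced by [D],
    then [D |- Bot] already makes the conclusion derivable.

    When the occurrence introduced by a left rule is itself replaced, it is the
    only one left to treat, and the mix is pushed through the derivation of
    [D |- a] instead ([left_reduction]).  All the rules that act on the
    antecedent permute with it, which leaves the identity axiom and the right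
    rules for the main connective of [a]; the latter reduce to cuts on the
    immediate subformulas of [a]. *)

(** * Contexts and replacement *)

(** Composition of contexts: [E] is put into the hole of [C]. *)
Fixpoint comp (C E : ctx) : ctx :=
  match C with
  | Hole => E
  | ODotL C G => ODotL (comp C E) G
  | ODotR G C => ODotR G (comp C E)
  | OMeetL C G => OMeetL (comp C E) G
  | OMeetR G C => OMeetR G (comp C E)
  end.

Lemma fill_comp C E G : fill (comp C E) G = fill C (fill E G).
Proof. induction C; simpl; congruence. Qed.

(** [repl a D G G']: the structure [G'] is obtained from [G] by replacing some
    occurrences (possibly none) of the leaf [a] by [D]. *)
Inductive repl (a : formula) (D : structure) : structure -> structure -> Prop :=
| repl_hole : repl a D (Leaf a) D
| repl_leaf x : repl a D (Leaf x) (Leaf x)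
| repl_odot G H G' H' :
    repl a D G G' -> repl a D H H' -> repl a D (ODot G H) (ODot G' H')
| repl_omeet G H G' H' :
    repl a D G G' -> repl a D H H' -> repl a D (OMeet G H) (OMeet G' H').

#[local] Hint Constructors repl : core.

Lemma repl_refl a D G : repl a D G G.
Proof. induction G; auto. Qed.

#[local] Hint Resolve repl_refl : core.

Lemma repl_mfill a D M : repl a D (mfill M (Leaf a)) (mfill M D).
Proof. induction M; simpl; auto. Qed.

Lemma repl_fill a D C X X' :
  repl a D X X' -> repl a D (fill C X) (fill C X').
Proof. induction C; simpl; auto. Qed.

Lemma repl_leaf_inv a D x X :
  repl a D (Leaf x) X -> X = Leaf x \/ (x = a /\ X = D).
Proof. inversion 1; auto. Qed.

Lemma repl_odot_inv a D G H X :
  repl a D (ODot G H) X ->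
  exists G' H', X = ODot G' H' /\ repl a D G G' /\ repl a D H H'.
Proof. inversion 1; eauto. Qed.

Lemma repl_omeet_inv a D G H X :
  repl a D (OMeet G H) X ->
  exists G' H', X = OMeet G' H' /\ repl a D G G' /\ repl a D H H'.
Proof. inversion 1; eauto. Qed.

(** A replacement in [fill C X] acts on the context and on [X] separately, and
    its action on the context does not depend on what fills the hole. *)
Lemma repl_fill_inv a D C X Z :
  repl a D (fill C X) Z ->
  exists C' X', Z = fill C' X' /\ repl a D X X' /\
    forall Y Y', repl a D Y Y' -> repl a D (fill C Y) (fill C' Y').
Proof.
  revert Z; induction C; simpl; intros Z HZ.
  - exists Hole, Z; auto.
  - apply repl_odot_inv in HZ as (Z1 & Z2 & -> & H1 & H2).
    destruct (IHC _ H1) as (C' & X' & -> & HX & HC).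
    exists (ODotL C' Z2), X'; simpl; auto.
  - apply repl_odot_inv in HZ as (Z1 & Z2 & -> & H1 & H2).
    destruct (IHC _ H2) as (C' & X' & -> & HX & HC).
    exists (ODotR Z1 C'), X'; simpl; auto.
  - apply repl_omeet_inv in HZ as (Z1 & Z2 & -> & H1 & H2).
    destruct (IHC _ H1) as (C' & X' & -> & HX & HC).
    exists (OMeetL C' Z2), X'; simpl; auto.
  - apply repl_omeet_inv in HZ as (Z1 & Z2 & -> & H1 & H2).
    destruct (IHC _ H2) as (C' & X' & -> & HX & HC).
    exists (OMeetR Z1 C'), X'; simpl; auto.
Qed.

(** * Replacement in instances of linear formulas *)

Lemma ssubst_ext s t chi :
  (forall p, 1 <= occ p chi -> s p = t p) -> ssubst s chi = ssubst t chi.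
Proof.
  induction chi; simpl; intros Hst; auto.
  - apply Hst. rewrite Nat.eqb_refl; auto.
  - f_equal; [apply IHchi1 | apply IHchi2]; intros p Hp; apply Hst; lia.
Qed.

Lemma repl_ssubst s a D chi s' :
  (forall p, repl a D (s p) (s' p)) ->
  repl a D (ssubst s chi) (ssubst s' chi).
Proof. intros Hs; induction chi; simpl; auto. Qed.

(** A replacement in an instance of a linear formula without [BTop] comes from a
    replacement in the substitution, unless it replaces an occurrence of [Bot]. *)
Lemma repl_ssubst_inv a D s chi X :
  linear chi -> top_free chi -> repl a D (ssubst s chi) X ->
  (exists s', X = ssubst s' chi /\ forall p, repl a D (s p) (s' p)) \/
  (a = Bot /\ exists C, X = fill C D).
Proof.
  revert X; induction chi as [p| | |chi1 IH1 chi2 IH2]; simpl;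
    intros X Hlin Htop HX.
  - left. exists (fun q => if Nat.eqb p q then X else s q).
    rewrite Nat.eqb_refl; split; auto.
    intros q; destruct (Nat.eqb_spec p q) as [->|_]; auto.
  - destruct Htop.
  - apply repl_leaf_inv in HX as [-> | [<- ->]].
    + left; exists s; auto.
    + right; split; auto. exists Hole; auto.
  - apply repl_odot_inv in HX as (X1 & X2 & -> & H1 & H2).
    destruct Htop as [Htop1 Htop2].
    assert (Hlin1 : linear chi1).
    { intros p Hp. specialize (Hlin p); simpl in Hlin; lia. }
    assert (Hlin2 : linear chi2).
    { intros p Hp. specialize (Hlin p); simpl in Hlin; lia. }
    destruct (IH1 _ Hlin1 Htop1 H1) as [(s1 & -> & Hs1) | (-> & C & ->)];
      [destruct (IH2 _ Hlin2 Htop2 H2) as [(s2 & -> & Hs2) | (-> & C & ->)]|].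
    + left.
      (* By linearity the variables of [chi1] and [chi2] are disjoint, so the two
         substitutions can be glued. *)
      exists (fun p => if Nat.eqb (occ p chi1) 0 then s2 p else s1 p).
      split.
      * f_equal; apply ssubst_ext; intros p Hp;
          destruct (Nat.eqb_spec (occ p chi1) 0); auto; try lia.
        specialize (Hlin p); simpl in Hlin; lia.
      * intros p; destruct (Nat.eqb (occ p chi1) 0); auto.
    + right; split; auto. exists (ODotR (ssubst s1 chi1) C); auto.
    + right; split; auto. exists (ODotL C X2); auto.
Qed.

(** * Reduction of the left premiss *)

(** The premisses of a right rule (or of [ax_top]) with conclusion [G |- a]. *)
Definition right_intro Psi (G : structure) (a : formula) : Prop :=
  match a with
  | Var _ | Bot => False
  | Top => True
  | And x y =>
      exists G1 G2, G = OMeet G1 G2 /\ derivable Psi G1 x /\ derivable Psi G2 y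
  | Or x y => derivable Psi G x \/ derivable Psi G y
  | Imp x y => derivable Psi (ODot (Leaf x) G) y
  | Fus x y =>
      exists G1 G2, G = ODot G1 G2 /\ derivable Psi G1 x /\ derivable Psi G2 y
  | Coimp x y => derivable Psi (ODot G (Leaf y)) x
  end.

(** To replace [a] by any [G] with [G |- a] in the context [C], it is enough to
    treat the identity axiom and the right rules for [a]: every other rule
    transforms [G] alone, and can be applied inside [C]. *)
Lemma left_reduction Psi C a c :
  derivable Psi (fill C (Leaf a)) c ->
  (forall G, right_intro Psi G a -> derivable Psi (fill C G) c) ->
  forall G, derivable Psi G a -> derivable Psi (fill C G) c.
Proof.
  intros Hid Hright G HG; revert Hid Hright.
  induction HG; intros Hid Hright;
    try (apply Hright; simpl; eauto; fail);
    rewrite <- ?fill_comp in *; auto.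
  - apply ax_bot.
  - apply imp_l; auto.
  - apply coimp_l; auto.
  - apply fus_l; auto.
  - apply and_l; auto.
  - apply or_l; auto.
  - apply contraction; auto.
  - apply weakening; auto.
  - apply exchange; auto.
  - apply associativity; auto.
  - apply odot_rule; auto.
Qed.

Lemma derivable_fill_bot Psi C D c :
  derivable Psi D Bot -> derivable Psi (fill C D) c.
Proof.
  apply left_reduction; [apply ax_bot | intros G []].
Qed.

(** * Mix *)

(** Mix with mix formula [a] is admissible; the occurrences of [a] to be replaced
    are given by [repl] instead of a context with several holes. *)
Definition mix_formula Psi (a : formula) : Prop :=
  forall D G G' c,
    derivable Psi D a -> derivable Psi G c -> repl a D G G' ->
    derivable Psi G' c.

Lemma mix_formula_cut Psi a C D c :
  mix_formula Psi a -> derivable Psi D a ->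
  derivable Psi (fill C (Leaf a)) c -> derivable Psi (fill C D) c.
Proof. intros Ha HD Hc; eapply Ha; eauto using repl_fill, repl_hole. Qed.

(** The induction hypothesis on the mix formula: mix holds for the immediate
    subformulas of [a]. *)
Definition mix_subformulas Psi (a : formula) : Prop :=
  match a with
  | Var _ | Top | Bot => True
  | And x y | Or x y | Imp x y | Fus x y | Coimp x y =>
      mix_formula Psi x /\ mix_formula Psi y
  end.

Lemma mix_step Psi
  (Hlin : forall sigma, Psi sigma -> linear (ante sigma))
  (Htop : forall sigma, Psi sigma -> top_free (ante sigma)) a :
  mix_subformulas Psi a -> mix_formula Psi a.
Proof.
  intros Hsub D G G' c HD HG; revert G'.
  induction HG; intros Z HZ;
    try (apply repl_fill_inv in HZ as (C' & X' & -> & HX & HC)).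
  - (* identity *)
    apply repl_leaf_inv in HZ as [-> | [-> ->]]; auto using ax_id.
  - (* Top axiom *)
    apply ax_top.
  - (* Bot axiom *)
    apply repl_leaf_inv in HX as [-> | [<- ->]].
    + apply ax_bot.
    + apply derivable_fill_bot; auto.
  - (* Imp, left *)
    apply repl_odot_inv in HX as (D' & L' & -> & HD' & HL).
    assert (Hx : derivable Psi D' a0) by auto.
    assert (Hy : derivable Psi (fill C' (Leaf b)) c) by auto.
    apply repl_leaf_inv in HL as [-> | [<- ->]].
    + apply imp_l; auto.
    + (* The replaced leaf is the principal formula; only this occurrence is
         still to be replaced, so the left premiss is reduced. *)
      destruct Hsub as [Hcx Hcy].
      change (derivable Psi (fill C' (fill (ODotR D' Hole) D)) c).
      rewrite <- fill_comp; apply left_reduction with (a := Imp a0 b); auto;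
        rewrite ?fill_comp; simpl.
      * apply imp_l; auto.
      * intros G HG; rewrite fill_comp; simpl.
        apply mix_formula_cut with b; auto.
        apply mix_formula_cut with (C := ODotL Hole G) (a := a0); auto.
  - (* Imp, right *)
    apply imp_r; auto.
  - (* Coimp, left *)
    apply repl_odot_inv in HX as (L' & D' & -> & HL & HD').
    assert (Hy : derivable Psi D' b) by auto.
    assert (Hx : derivable Psi (fill C' (Leaf a0)) c) by auto.
    apply repl_leaf_inv in HL as [-> | [<- ->]].
    + apply coimp_l; auto.
    + destruct Hsub as [Hcx Hcy].
      change (derivable Psi (fill C' (fill (ODotL Hole D') D)) c).
      rewrite <- fill_comp; apply left_reduction with (a := Coimp a0 b); auto;
        rewrite ?fill_comp; simpl.
      * apply coimp_l; auto.
      * intros G HG; rewrite fill_comp; simpl.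
        apply mix_formula_cut with a0; auto.
        apply mix_formula_cut with (C := ODotR G Hole) (a := b); auto.
  - (* Coimp, right *)
    apply coimp_r; auto.
  - (* Fus, left *)
    assert (Hxy : derivable Psi (fill C' (ODot (Leaf a0) (Leaf b))) c) by auto.
    apply repl_leaf_inv in HX as [-> | [<- ->]].
    + apply fus_l; auto.
    + destruct Hsub as [Hcx Hcy].
      apply left_reduction with (a := Fus a0 b); auto using fus_l.
      intros G (G1 & G2 & -> & H1 & H2).
      apply Hcx with G1 (fill C' (ODot (Leaf a0) G2)); auto using repl_fill.
      apply Hcy with G2 (fill C' (ODot (Leaf a0) (Leaf b))); auto using repl_fill.
  - (* Fus, right *)
    apply repl_odot_inv in HZ as (G1 & G2 & -> & H1 & H2).
    apply fus_r; auto.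
  - (* And, left *)
    assert (Hxy : derivable Psi (fill C' (OMeet (Leaf a0) (Leaf b))) c) by auto.
    apply repl_leaf_inv in HX as [-> | [<- ->]].
    + apply and_l; auto.
    + destruct Hsub as [Hcx Hcy].
      apply left_reduction with (a := And a0 b); auto using and_l.
      intros G (G1 & G2 & -> & H1 & H2).
      apply Hcx with G1 (fill C' (OMeet (Leaf a0) G2)); auto using repl_fill.
      apply Hcy with G2 (fill C' (OMeet (Leaf a0) (Leaf b))); auto using repl_fill.
  - (* And, right *)
    apply repl_omeet_inv in HZ as (G1 & G2 & -> & H1 & H2).
    apply and_r; auto.
  - (* Or, left *)
    assert (Hx : derivable Psi (fill C' (Leaf a0)) c) by auto.
    assert (Hy : derivable Psi (fill C' (Leaf b)) c) by auto.
    apply repl_leaf_inv in HX as [-> | [<- ->]].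
    + apply or_l; auto.
    + destruct Hsub as [Hcx Hcy].
      apply left_reduction with (a := Or a0 b); auto using or_l.
      intros G [HG | HG]; eauto using mix_formula_cut.
  - (* Or, right *)
    apply or_r1; auto.
  - apply or_r2; auto.
  - (* structural rules *)
    apply contraction; auto.
  - apply repl_omeet_inv in HX as (S' & D' & -> & HS & HD').
    apply weakening; auto.
  - apply repl_omeet_inv in HX as (L' & D' & -> & HL & HD').
    apply exchange; auto.
  - apply repl_omeet_inv in HX as (D1' & Y & -> & HD1 & HY).
    apply repl_omeet_inv in HY as (D2' & D3' & -> & HD2 & HD3).
    apply associativity; auto.
  - (* rule of a sequent of Psi *)
    apply repl_ssubst_inv in HX as [(s' & -> & Hs) | (-> & E & ->)]; auto.
    + apply odot_rule; auto using repl_ssubst.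
    + rewrite <- fill_comp; apply derivable_fill_bot; auto.
Qed.

Lemma mix_all_formulas Psi
  (Hlin : forall sigma, Psi sigma -> linear (ante sigma))
  (Htop : forall sigma, Psi sigma -> top_free (ante sigma)) a :
  mix_formula Psi a.
Proof. induction a; apply mix_step; simpl; auto. Qed.

Theorem theorem13 (Psi : bsequent -> Prop)
  (Hlin : forall sigma, Psi sigma -> linear (ante sigma))
  (Htop : forall sigma, Psi sigma -> top_free (ante sigma)) :
  admissible Psi mix.
Proof.
  intros prems concl HR Hprems.
  destruct HR as [M D a b _]; simpl.
  inversion_clear Hprems as [|? ? HD Htl].
  inversion_clear Htl as [|? ? HM _].
  apply mix_all_formulas with a D (mfill M (Leaf a)); auto using repl_mfill.
Qed.
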